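(* Let $\{A_k\}_{k=1}^\infty$ and $\{A'_k\}_{k=1}^\infty$ be two equivalent sequences of finite subsets of $\mathbb{R}^d$ with $\#A_k\ge 2$ and $\#A'_k\ge 2$ for every $k\ge 1$. Then the infinite convolution $\nu=\delta_{A_1}*\delta_{A_2}*\cdots$ of $\{A_k\}_{k=1}^\infty$ exists if and only if the infinite convolution $\nu'=\delta_{A'_1}*\delta_{A'_2}*\cdots$ of $\{A'_k\}_{k=1}^\infty$ exists.
   Context: $\#$ denotes cardinality. For a finite nonempty set $A\subseteq\mathbb{R}^d$, $\delta_A=\frac{1}{\#A}\sum_{a\in A}\delta_a$, where $\delta_a$ is the Dirac measure at $a$; $*$ denotes convolution of measures. The infinite convolution of $\{A_k\}_{k=1}^\infty$ is said to exist if the sequence $\nu_k=\delta_{A_1}*\delta_{A_2}*\cdots*\delta_{A_k}$ converges weakly, as $k\to\infty$, to a Borel probability measure $\nu$ on $\mathbb{R}^d$; this $\nu$ is then called the infinite convolution of $\{A_k\}_{k=1}^\infty$ and written $\nu=\delta_{A_1}*\delta_{A_2}*\cdots$. Two sequences of finite sets $\{A_k\}_{k=1}^\infty$ and $\{A'_k\}_{k=1}^\infty$ in $\mathbb{R}^d$ are called equivalent if $$\sum_{k=1}^{\infty}\Big(\frac{\#(A'_k\setminus A_k)}{\#A'_k}+\frac{\#(A_k\setminus A'_k)}{\#A_k}\Big)<\infty.$$ *)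

(* Defs.v *)
From HB Require Import structures.
From mathcomp Require Import all_boot all_order all_algebra finmap.
From mathcomp Require Import all_classical all_reals all_analysis.
From mathcomp Require Import measurable_realfun.

Set Implicit Arguments.
Unset Strict Implicit.
Unset Printing Implicit Defensive.

Import Order.TTheory GRing.Theory Num.Theory.
Import numFieldNormedType.Exports.

Local Open Scope classical_set_scope.
Local Open Scope ring_scope.

(* The Borel sigma-algebra. *)
HB.instance Definition _ (R : realType) (m n : nat) :=
  @isMeasurable.Build (sigma_display (@open 'M[R]_(m, n))) 'M[R]_(m, n)
    <<s @open 'M[R]_(m, n) >> (@sigma_algebra0 _ setT _)
    (@sigma_algebraC _ _) (@sigma_algebra_bigcup _ setT _).

Section borel_matrix.
Context {R : realType} {m n : nat}.

Lemma open_measurable_mx (U : set 'M[R]_(m, n)) : open U -> measurable U.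
Proof. exact: sub_sigma_algebra. Qed.

Lemma measurable_coord_mx (i : 'I_m) (j : 'I_n) :
  measurable_fun [set: 'M[R]_(m, n)] (fun M => M i j).
Proof.
apply: (measurability _ (RGenOpens.measurableE R)) => _ [_ [a [b ->]] <-].
rewrite setTI; apply: open_measurable_mx.
apply: open_comp => [M _|]; last exact: interval_open.
exact: coord_continuous.
Qed.

Lemma measurable_fun_mx d (T : measurableType d) (f : T -> 'M[R]_(m, n)) :
  (forall i j, measurable_fun [set: T] (fun x => f x i j)) ->
  measurable_fun [set: T] f.
Proof.
move=> mf; apply: (measurability (@open 'M[R]_(m, n)) _) => // _ [U oU <-].
rewrite setTI.
pose Q : countType := ('M[rat]_(m, n) * 'M[rat]_(m, n))%type.
pose box (q : Q) : set 'M[R]_(m, n) :=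
  [set M | forall i j, ratr (q.1 i j) < M i j < ratr (q.2 i j)].
have mbox q : measurable (f @^-1` box q).
  have -> : f @^-1` box q = \bigcap_(i in [set: 'I_m]) \bigcap_(j in [set: 'I_n])
      ((fun x => f x i j) @^-1` `]ratr (q.1 i j), ratr (q.2 i j)[%classic).
    apply/seteqP; split => x /=.
      by move=> qx i _ j _ /=; rewrite in_itv /= qx.
    by move=> qx i j; have := qx i I j I; rewrite /= in_itv.
  apply: fin_bigcap_measurable => [|i _]; first exact: finite_finset.
  apply: fin_bigcap_measurable => [|j _]; first exact: finite_finset.
  by rewrite -[X in measurable X]setTI; apply: mf.
pose F k := if @choice.unpickle Q k is Some q then
  if `[< box q `<=` U >] then f @^-1` box q else set0 else set0.
have -> : f @^-1` U = \bigcup_(k in [set: nat]) F k.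
  apply/seteqP; split => x /=; last first.
    by move=> [k _]; rewrite /F; case: choice.unpickle => // q; case: asboolP => // + qx; exact.
  move=> Ux; have [P fP PU] : nbhs (f x) U by exact: open_nbhs_nbhs.
  have q_ i j : {q : rat * rat | ratr q.1 < f x i j < ratr q.2 &
      `]ratr q.1, ratr q.2[%classic `<=` P i j}.
    apply: cid2; have /nbhs_ballP[e /= e0 eP] := fP i j.
    have /rat_in_itvoo[a] : f x i j - e < f x i j by rewrite ltrBlDr ltrDl.
    have /rat_in_itvoo[b] : f x i j < f x i j + e by rewrite ltrDl.
    rewrite !in_itv /= => /andP[xb be] /andP[ea ax].
    exists (a, b) => /=; first by rewrite ax xb.
    move=> y /=; rewrite in_itv /= => /andP[ay yb]; apply: eP.
    by rewrite /ball /= ltr_distlC (lt_trans ea ay) (lt_trans yb be).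
  pose q : Q := (\matrix_(i, j) (s2val (q_ i j)).1,
                 \matrix_(i, j) (s2val (q_ i j)).2).
  exists (choice.pickle q) => //; rewrite /F choice.pickleK; case: asboolP => [_|[]].
    by move=> i j /=; rewrite !mxE; case: (q_ i j).
  move=> M qM; apply: PU => i j; have := qM i j; rewrite !mxE.
  by case: (q_ i j) => /= -[a b] _ sP Mab; apply: sP; rewrite /= in_itv.
apply: bigcupT_measurable => k; rewrite /F; case: choice.unpickle => // q.
by case: asboolP => _; [exact: mbox|exact: measurable0].
Qed.

Lemma measurable_add_mx : measurable_fun
  [set: 'M[R]_(m, n) * 'M[R]_(m, n)] (fun z => z.1 + z.2).
Proof.
apply: measurable_fun_mx => i j.
under eq_fun do rewrite mxE.
by apply: measurable_funD; apply: (measurableT_comp (measurable_coord_mx i j)).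
Qed.

End borel_matrix.

Section uniform_measure.
Context {R : realType} {d : nat}.
Local Open Scope ereal_scope.
Implicit Types A : {fset 'rV[R]_d}.

(* The zero measure when A is empty. *)
Definition delta_fset A (B : set 'rV[R]_d) : \bar R :=
  (#|` A|%:R^-1)%R%:E * \sum_(a <- A) \d_a B.

Let delta_fsetE A : delta_fset A =
  mscale (#|` A|%:R^-1)%:nng%R
    (msum (fun k => @dirac _ 'rV[R]_d (nth 0%R A k) R) #|` A|).
Proof.
apply/funext => B; rewrite /delta_fset /mscale /msum /=; congr (_ * _).
by rewrite (big_nth 0%R) big_mkord.
Qed.

Let delta_fset0 A : delta_fset A set0 = 0.
Proof. by rewrite delta_fsetE measure0. Qed.

Let delta_fset_ge0 A B : 0 <= delta_fset A B.
Proof. by rewrite delta_fsetE measure_ge0. Qed.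

Let delta_fset_sigma_additive A : semi_sigma_additive (delta_fset A).
Proof. by rewrite delta_fsetE; exact: measure_semi_sigma_additive. Qed.

HB.instance Definition _ A := isMeasure.Build _ _ _ (delta_fset A)
  (delta_fset0 A) (delta_fset_ge0 A) (@delta_fset_sigma_additive A).

Let delta_fset_fin A : fin_num_fun (delta_fset A).
Proof.
move=> B mB; rewrite /delta_fset fin_numM//; apply/sum_fin_numP => a _ _.
exact: fin_num_measure.
Qed.

HB.instance Definition _ A :=
  Measure_isFinite.Build _ _ _ (delta_fset A) (@delta_fset_fin A).

End uniform_measure.

Section convolution.
Context {R : realType} {d : nat}.
Local Open Scope ereal_scope.
Implicit Types mu nu : {finite_measure set 'rV[R]_d -> \bar R}.

Definition convolution mu nu : set 'rV[R]_d -> \bar R :=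
  pushforward (mu \x nu) (fun z => (z.1 + z.2)%R).

Let convolution0 mu nu : convolution mu nu set0 = 0.
Proof. by rewrite /convolution /pushforward preimage_set0 measure0. Qed.

Let convolution_ge0 mu nu B : 0 <= convolution mu nu B.
Proof. by rewrite /convolution /pushforward; apply: measure_ge0. Qed.

Let convolution_sigma_additive mu nu : semi_sigma_additive (convolution mu nu).
Proof.
pose m : {measure set 'rV[R]_d -> \bar R} :=
  measure_function_pushforward__canonical__measure_function_Measure
    (mu \x nu) measurable_add_mx.
exact: (@measure_semi_sigma_additive _ _ _ m).
Qed.

HB.instance Definition _ mu nu := isMeasure.Build _ _ _ (convolution mu nu)
  (convolution0 mu nu) (convolution_ge0 mu nu) (@convolution_sigma_additive mu nu).

Let convolution_fin mu nu : fin_num_fun (convolution mu nu).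
Proof.
apply: lty_fin_num_fun => /=.
have -> : convolution mu nu setT = mu setT * nu setT.
  by rewrite /convolution /pushforward preimage_setT -setXTT product_measure1E.
by rewrite lte_mul_pinfty ?fin_num_measure// -ge0_fin_numE ?fin_num_measure.
Qed.

HB.instance Definition _ mu nu :=
  Measure_isFinite.Build _ _ _ (convolution mu nu) (@convolution_fin mu nu).

End convolution.

Section infinite_convolution.
Context {R : realType} {d : nat}.
Local Open Scope ereal_scope.
Implicit Types A : nat -> {fset 'rV[R]_d}.

(* The sets A_1, A_2, ... are A 0, A 1, ..., so that conv_seq A k is nu_(k+1). *)
Fixpoint conv_seq A (k : nat) : {finite_measure set 'rV[R]_d -> \bar R} :=
  if k is k'.+1 then convolution (conv_seq A k') (delta_fset (A k))
  else delta_fset (A 0%N).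

Definition weakly_converges (mu_ : nat -> {measure set 'rV[R]_d -> \bar R})
    (mu : {measure set 'rV[R]_d -> \bar R}) : Prop :=
  forall f : 'rV[R]_d -> R, continuous f -> bounded_fun f ->
    \int[mu_ k]_x (f x)%:E @[k --> \oo] --> \int[mu]_x (f x)%:E.

Definition infinite_convolution_exists A : Prop :=
  exists nu : probability 'rV[R]_d R, weakly_converges (conv_seq A) nu.

Definition equivalent_seq A A' : Prop :=
  \sum_(0 <= k <oo)
    (#|` (A' k `\` A k)%fset|%:R / #|` A' k|%:R +
     #|` (A k `\` A' k)%fset|%:R / #|` A k|%:R)%R%:E < +oo :> \bar R.

End infinite_convolution.

(* Main.v *)
(* Let the X_j be independent and uniform on A_j, and S_k = X_1 + ... + X_k. The
   infinite convolution exists iff (S_k) is Cauchy in probability, i.e. the block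
   sums X_(n+1) + ... + X_(n+k) are uniformly small in probability for large n.

   If nu_k converges weakly, then (S_k) is tight, and so are the block sums. At a
   small enough frequency t the characteristic functions of the S_n converge and
   stay away from 0, so those of the blocks, which are their quotients, tend to 1
   at t; for a tight family this single frequency (small compared with the
   inverse of the tightness radius) already forces smallness in probability.

   Conversely, realise the X_j on [0, 1) as functions of the mixed radix digits of
   a uniform variable. A fast subsequence of (S_k) converges almost surely, and
   the law of the limit is the infinite convolution.

   The Cauchy condition passes from A to A': replacing each factor of a block
   changes probabilities by at most a tail of the series defining equivalence. *)

Require Import Defs.
From HB Require Import structures.
From mathcomp Require Import all_boot all_order all_algebra finmap.
From mathcomp Require Import all_classical all_reals all_analysis.
From mathcomp Require Import measurable_realfun ring lra.

Set Implicit Arguments.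
Unset Strict Implicit.
Unset Printing Implicit Defensive.

Import Order.TTheory GRing.Theory Num.Theory.
Import numFieldNormedType.Exports.

Local Open Scope classical_set_scope.
Local Open Scope ring_scope.

(** * Finite averages *)

Section average.
Context {R : realType} {V : zmodType}.
Implicit Types (A B : {fset V}) (f g : V -> R).

Definition avg A f : R := #|` A|%:R^-1 * \sum_(a <- A) f a.

Lemma avgD A f g : avg A (fun x => f x + g x) = avg A f + avg A g.
Proof. by rewrite /avg big_split mulrDr. Qed.

Lemma avgZ A c f : avg A (fun x => c * f x) = c * avg A f.
Proof. by rewrite /avg -mulr_sumr mulrCA. Qed.

Lemma avg_cst A c : (0 < #|` A|)%N -> avg A (fun=> c) = c.
Proof.
move=> A0; rewrite /avg big_const_seq count_predT iter_addr_0.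
by rewrite -[c *+ _]mulr_natl mulKf// pnatr_eq0 -lt0n.
Qed.

Lemma le_avg A f g : (forall x, f x <= g x) -> avg A f <= avg A g.
Proof. by move=> fg; rewrite ler_wpM2l ?invr_ge0// ler_sum. Qed.

(** Over the common part the two sums differ only in the weights [1/#A] and [1/#B]; the rest is
    carried by the two set differences. Each of these contributions is at most the bracket, whence
    the factor 2. *)
Lemma avg_dist_le A B f : (0 < #|` A|)%N -> (0 < #|` B|)%N ->
  (forall x, `|f x| <= 1) ->
  `|avg A f - avg B f| <= 2 * (#|` (B `\` A)%fset|%:R / #|` B|%:R +
                               #|` (A `\` B)%fset|%:R / #|` A|%:R).
Proof.
move=> A0 B0 f1.
have sumI (C D : {fset V}) : \sum_(a <- C) f a =
    \sum_(a <- (C `&` D)%fset) f a + \sum_(a <- (C `\` D)%fset) f a.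
  rewrite (big_fsetID _ (mem D)); congr (_ + _); apply: eq_fbigl => x;
    by rewrite !inE //= andbC.
have bound (C : {fset V}) : `|\sum_(a <- C) f a| <= #|` C|%:R.
  rewrite (le_trans (ler_norm_sum _ _ _))// (le_trans (ler_sum _ (fun i _ => f1 i)))//.
  by rewrite big_const_seq count_predT iter_addr_0.
have card (C D : {fset V}) :
    #|` C|%:R = #|` (C `&` D)%fset|%:R + #|` (C `\` D)%fset|%:R :> R.
  by rewrite -natrD cardfsID.
rewrite /avg (sumI A B) (sumI B A) fsetIC.
have := bound (B `&` A)%fset; have := bound (A `\` B)%fset; have := bound (B `\` A)%fset.
have := card A B; have := card B A; rewrite (fsetIC A B).
set a : R := #|` A|%:R; set b : R := #|` B|%:R.
set p : R := #|` (B `&` A)%fset|%:R; set q : R := #|` (A `\` B)%fset|%:R.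
set r : R := #|` (B `\` A)%fset|%:R.
set P := \sum_(_ <- (B `&` A)%fset) _; set Q := \sum_(_ <- (A `\` B)%fset) _.
set S := \sum_(_ <- (B `\` A)%fset) _ => bE aE SB QA PI.
have a0 : 0 < a by rewrite ltr0n.
have b0 : 0 < b by rewrite ltr0n.
have -> : a^-1 * (P + Q) - b^-1 * (P + S) =
  (a^-1 - b^-1) * P + (Q / a - S / b) by ring.
have pab : `|(a^-1 - b^-1) * P| <= r / b + q / a.
  rewrite normrM (le_trans (ler_wpM2l _ PI))//.
  (* Here [p / a = 1 - q / a] and [p / b = 1 - r / b]. *)
  have -> : `|a^-1 - b^-1| * p = `|r / b - q / a|.
    rewrite -[p in LHS]ger0_norm// -normrM; congr (`|_|).
    have -> : p = a - q by rewrite aE addrK.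
    have -> : r = b - (a - q) by lra.
    by field; rewrite !gt_eqF.
  by rewrite (le_trans (ler_normB _ _))// !ger0_norm// divr_ge0// ltW.
rewrite (le_trans (ler_normD _ _))// mulr_natl mulr2n lerD//.
rewrite (le_trans (ler_normB _ _))// addrC.
by rewrite lerD// normrM normfV (gtr0_norm a0, gtr0_norm b0) ler_pM2r ?invr_gt0.
Qed.
End average.

(* [expect A n k f] is the expectation of [f (a_n + ... + a_(n+k-1))] where the
   [a_j] are independent and uniform on [A j]. *)
Section expect.
Context {R : realType} {V : zmodType}.
Implicit Types (A B : nat -> {fset V}) (f g : V -> R).

Fixpoint expect A (n k : nat) f : R :=
  if k is k'.+1 then avg (A n) (fun a => expect A n.+1 k' (fun x => f (a + x)))
  else f 0.

Lemma expectD A n k f g :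
  expect A n k (fun x => f x + g x) = expect A n k f + expect A n k g.
Proof.
elim: k n f g => //= k IH n f g; rewrite -avgD; congr avg.
by apply/funext => a; rewrite IH.
Qed.

Lemma expectZ A n k c f : expect A n k (fun x => c * f x) = c * expect A n k f.
Proof.
elim: k n f => //= k IH n f; rewrite -avgZ; congr avg.
by apply/funext => a; rewrite IH.
Qed.

Lemma expectN A n k f : expect A n k (fun x => - f x) = - expect A n k f.
Proof.
rewrite -mulN1r -expectZ; congr expect.
by apply/funext => x; rewrite mulN1r.
Qed.

Lemma expectB A n k f g :
  expect A n k (fun x => f x - g x) = expect A n k f - expect A n k g.
Proof. by rewrite expectD expectN. Qed.

Lemma le_expect A n k f g : (forall x, f x <= g x) ->
  expect A n k f <= expect A n k g.
Proof.
elim: k n f g => //= k IH n f g fg; apply: le_avg => a.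
by apply: IH => x; exact: fg.
Qed.

Lemma expect_cst A n k c : (forall j, (0 < #|` A j|)%N) ->
  expect A n k (fun=> c) = c.
Proof.
move=> A0; elim: k n => //= k IH n.
rewrite -[RHS](avg_cst c (A0 n)); congr avg.
by apply/funext => a; rewrite IH.
Qed.

Lemma expect_norm_le A n k f c : (forall j, (0 < #|` A j|)%N) ->
  (forall x, `|f x| <= c) -> `|expect A n k f| <= c.
Proof.
move=> A0 fc; rewrite ler_norml.
rewrite -{1}(expect_cst n k (- c) A0) -{2}(expect_cst n k c A0) !le_expect//.
  by move=> x; have := fc x; rewrite ler_norml => /andP[].
by move=> x; have := fc x; rewrite ler_norml => /andP[].
Qed.

Lemma expect_split A n j k f : expect A n (j + k) f =
  expect A n j (fun x => expect A (n + j) k (fun y => f (x + y))).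
Proof.
elim: j n f => [|j IH] n f /=.
  by rewrite addn0; congr expect; apply/funext => x; rewrite add0r.
congr avg; apply/funext => a; rewrite IH addSnnS; congr expect.
by apply/funext => x; congr expect; apply/funext => y; rewrite addrA.
Qed.

(** [expect] peels off the first summand while [conv_seq] appends a last one; this form matches the
    latter. *)
Lemma expectS A n k f : expect A n k.+1 f =
  expect A n k (fun x => avg (A (n + k)%N) (fun a => f (x + a))).
Proof.
rewrite -addn1 expect_split /=; congr expect; apply/funext => x; congr avg.
by apply/funext => a; rewrite addr0.
Qed.

(** The factors are exchanged one at a time. Each exchange costs [avg_dist_le], since averaging over
    the other factors keeps the integrand bounded by 1. *)
Lemma expect_dist_le A B n k f : (forall j, (0 < #|` A j|)%N) ->
    (forall j, (0 < #|` B j|)%N) -> (forall x, `|f x| <= 1) ->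
  `|expect A n k f - expect B n k f| <=
  2 * \sum_(n <= j < n + k) (#|` (B j `\` A j)%fset|%:R / #|` B j|%:R +
                         #|` (A j `\` B j)%fset|%:R / #|` A j|%:R).
Proof.
move=> A0 B0; elim: k n f => /= [|k IH] n f f1.
  by rewrite addn0 big_geq// mulr0 subrr normr0.
rewrite big_ltn ?addnS ?ltnS ?leq_addr// mulrDr -addSn.
set a := fun _ => expect A _ _ _; set b := fun _ => expect B _ _ _.
(* The intermediate term draws the first point from [B n] and all later ones from [A]. *)
have -> : avg (A n) a - avg (B n) b =
    avg (A n) a - avg (B n) a + (avg (B n) a - avg (B n) b) by ring.
rewrite (le_trans (ler_normD _ _))// lerD//.
  by apply: avg_dist_le => // x; exact: expect_norm_le.
have abE x : `|a x - b x| <= 2 * \sum_(n.+1 <= j < n.+1 + k)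
    (#|` (B j `\` A j)%fset|%:R / #|` B j|%:R +
     #|` (A j `\` B j)%fset|%:R / #|` A j|%:R).
  exact: IH.
rewrite -[- avg _ b]mulN1r -avgZ -avgD ler_norml.
set c := _ * _ in abE *.
rewrite -{1}(avg_cst (- c) (B0 n)) -{2}(avg_cst c (B0 n)) !le_avg// => x;
  by have := abE x; rewrite ler_norml mulN1r => /andP[].
Qed.
End expect.

(** * Integrals against finite convolutions *)

Section integral_delta.
Context {R : realType} {d : nat}.
Implicit Types (A : {fset 'rV[R]_d}) (f : 'rV[R]_d -> R).

Lemma continuous_measurable_mx f : continuous f -> measurable_fun [set: 'rV[R]_d] f.
Proof.
move=> cf; apply: (measurability _ (RGenOpens.measurableE R)) => _ [_ [a [b ->]] <-].
rewrite setTI; apply: open_measurable_mx.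
by apply: open_comp => [M _|]; [exact: cf|exact: interval_open].
Qed.

Lemma measurable_addr_mx (a : 'rV[R]_d) : measurable_fun [set: 'rV[R]_d] (fun x => x + a).
Proof.
apply: (measurableT_comp measurable_add_mx (g := fun x : 'rV[R]_d => (x, a))).
by apply: measurable_fun_pair => //; exact: measurable_cst.
Qed.

Lemma measurable_addl_mx (a : 'rV[R]_d) : measurable_fun [set: 'rV[R]_d] (fun x => a + x).
Proof.
by under eq_fun do rewrite addrC; exact: measurable_addr_mx.
Qed.

Lemma measurable_avg_translate A f : measurable_fun [set: 'rV[R]_d] f ->
  measurable_fun [set: 'rV[R]_d] (fun x => avg A (fun a => f (x + a))).
Proof.
move=> mf; apply: measurable_funM; first exact: measurable_cst.
apply: measurable_sum => a.
exact: (measurableT_comp mf (measurable_addr_mx _)).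
Qed.

Lemma avg_ge0 A f : (forall x, 0 <= f x) -> 0 <= avg A f.
Proof. by move=> f0; rewrite mulr_ge0 ?invr_ge0// sumr_ge0. Qed.

Lemma ge0_integral_delta A f : measurable_fun [set: 'rV[R]_d] f -> (forall x, 0 <= f x) ->
  (\int[delta_fset A]_x (f x)%:E = (avg A f)%:E)%E.
Proof.
move=> mf f0; have mEf : measurable_fun [set: 'rV[R]_d] (EFin \o f) by exact/measurable_EFinP.
pose m k : {measure set 'rV[R]_d -> \bar R} := @dirac _ 'rV[R]_d (nth 0%R A k) R.
rewrite (eq_measure_integral (mscale (#|` A|%:R^-1)%:nng%R (msum m #|` A|))); last first.
  move=> B mB _; rewrite /= /delta_fset /mscale /msum /=; congr (_ * _)%E.
  by rewrite (big_nth 0%R) big_mkord.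
rewrite ge0_integral_mscale//; last by move=> x _; rewrite lee_fin.
rewrite ge0_integral_measure_sum//; last by move=> x _; rewrite lee_fin.
rewrite /avg EFinM; congr (_ * _)%E.
rewrite (big_nth 0%R) big_mkord -sumEFin; apply: eq_bigr => i _.
by rewrite integral_dirac// diracT mul1e.
Qed.

Lemma ge0_integral_convolution (mu : {finite_measure set 'rV[R]_d -> \bar R}) A f :
    measurable_fun [set: 'rV[R]_d] f -> (forall x, 0 <= f x) ->
  (\int[convolution mu (delta_fset A)]_x (f x)%:E =
   \int[mu]_x (avg A (fun a => f (x + a)%R))%:E)%E.
Proof.
move=> mf f0; have mEf : measurable_fun [set: 'rV[R]_d] (EFin \o f) by exact/measurable_EFinP.
rewrite (ge0_integral_pushforward measurable_add_mx)//; last first.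
  by move=> x _; rewrite lee_fin.
rewrite preimage_setT fubini_tonelli1//=; last 2 first.
  exact: (measurableT_comp mEf measurable_add_mx).
  by move=> x; rewrite lee_fin.
apply: eq_integral => x _; rewrite /fubini_F /=.
rewrite (ge0_integral_delta _ (f := fun a => f (x + a)))//.
exact: (measurableT_comp mf (measurable_addl_mx _)).
Qed.

Lemma ge0_integral_conv_seq (A : nat -> {fset 'rV[R]_d}) k f :
    measurable_fun [set: 'rV[R]_d] f -> (forall x, 0 <= f x) ->
  (\int[conv_seq A k]_x (f x)%:E = (expect A 0 k.+1 f)%:E)%E.
Proof.
elim: k f => [|k IH] f mf f0.
  rewrite /conv_seq ge0_integral_delta//= /avg; congr (_ * _)%:E.
  by apply: eq_bigr => a _; rewrite addr0.
rewrite [conv_seq _ _]/= ge0_integral_convolution// expectS IH//.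
  exact: measurable_avg_translate.
by move=> x; exact: avg_ge0.
Qed.

Lemma conv_seq_setT (A : nat -> {fset 'rV[R]_d}) k :
  (forall j, (0 < #|` A j|)%N) -> conv_seq A k setT = 1%E.
Proof.
move=> A0; rewrite -[LHS]mul1e -integral_cst//.
by rewrite (ge0_integral_conv_seq A k (f := cst 1%R))// expect_cst.
Qed.

End integral_delta.

(** Integral formulas proved by Tonelli for nonnegative functions extend to bounded ones: add a
    constant [M] making [f] nonnegative, then cancel it. *)
Lemma integral_shift_eq d (T : measurableType d) (R : realType)
    (mu : {measure set T -> \bar R}) (f : T -> R) (c M : R) :
    mu setT = 1%E -> measurable_fun setT f -> bounded_fun f ->
    (\int[mu]_x (f x + M)%:E = (c + M)%:E)%E ->
  (\int[mu]_x (f x)%:E = c%:E)%E.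
Proof.
move=> mu1 mf bf.
have mu_int (g : T -> R) : measurable_fun setT g -> bounded_fun g ->
    mu.-integrable setT (EFin \o g).
  by move=> mg bg; apply: measurable_bounded_integrable => //; rewrite mu1 ltry.
under eq_integral do rewrite EFinD.
rewrite (integralD _ (mu_int _ _ _) (mu_int (cst M) _ _))//; last exact: bounded_cst.
rewrite (_ : integral _ _ (EFin \o cst M) = M%:E); last first.
  by rewrite -[RHS]mule1 -mu1 -integral_cst.
have := integrable_fin_num measurableT (mu_int _ mf bf).
rewrite /comp; case: (\int[mu]_x (f x)%:E)%E => // r _ [] /addIr ->//.
Qed.

Lemma bounded_fun_norm_le (T : Type) (R : realType) (f : T -> R) :
  bounded_fun f -> exists2 M : R, 0 < M & forall x, `|f x| <= M.
Proof.
move=> [M [_ fM]]; exists (`|M| + 1); first by rewrite ltr_wpDl.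
by move=> x; apply: fM => //; rewrite ltr_pwDr// ler_norm.

Qed.

Lemma norm_le_bounded_fun (T : Type) (R : realType) (f : T -> R) M :
  (forall x, `|f x| <= M) -> bounded_fun f.
Proof.
move=> fM; exists M; split; first exact: num_real.
by move=> N MN x _ /=; exact: le_trans (fM x) (ltW MN).
Qed.

Lemma integral_conv_seq (R : realType) (d : nat) (A : nat -> {fset 'rV[R]_d}) k
    (f : 'rV[R]_d -> R) :
    (forall j, (0 < #|` A j|)%N) -> measurable_fun setT f -> bounded_fun f ->
  (\int[conv_seq A k]_x (f x)%:E = (expect A 0 k.+1 f)%:E)%E.
Proof.
move=> A0 mf bf; have [M M0 fM] := bounded_fun_norm_le bf.
have mfM : measurable_fun setT (fun x => f x + M) by exact: measurable_funD.
apply: (@integral_shift_eq _ _ _ (conv_seq A k) f _ M) => //.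
  exact: conv_seq_setT.
rewrite ge0_integral_conv_seq//.
  by rewrite expectD [X in _ + X](expect_cst 0 k.+1 M A0).
by move=> x; rewrite -lerBlDr sub0r; have := fM x; rewrite ler_norml => /andP[].
Qed.

(** * Existence of the infinite convolution bounds the block sums *)

Section necessity.
Context {R : realType} {d : nat}.
Implicit Types (A : nat -> {fset 'rV[R]_d}) (f : 'rV[R]_d -> R) (i : 'I_d).

Lemma expect_cvg A : (forall j, (0 < #|` A j|)%N) ->
    infinite_convolution_exists A ->
  exists nu : probability 'rV[R]_d R, forall f, continuous f -> bounded_fun f ->
    expect A 0 k f @[k --> \oo] --> fine (\int[nu]_x (f x)%:E).
Proof.
move=> A0 [nu Anu]; exists nu => f cf bf.
(* [conv_seq A k] has [k.+1] factors. *)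
rewrite -(cvg_shiftS (fun k => expect A 0 k f)) /=.
have nuf : (\int[nu]_x (f x)%:E)%E \is a fin_num.
  apply: integrable_fin_num => //; apply: measurable_bounded_integrable => //.
    by rewrite [X in (X < _)%E](probability_setT nu) ltry.
  exact: continuous_measurable_mx.
have := Anu f cf bf; rewrite -(fineK nuf) => /fine_cvgP[_].
rewrite (_ : fine \o _ = fun k => expect A 0 k.+1 f)//; apply/funext => k /=.
by rewrite integral_conv_seq//; exact: continuous_measurable_mx.
Qed.

Lemma continuous_comp_coord (phi : R -> R) i : continuous phi ->
  continuous (fun x : 'rV[R]_d => phi (x 0 i)).
Proof.
move=> cphi x; apply: (@continuous_comp _ _ _ (fun x : 'rV[R]_d => x 0 i)).
  exact: coord_continuous.
exact: cphi.
Qed.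

Lemma expect_tight A i : (forall j, (0 < #|` A j|)%N) ->
    infinite_convolution_exists A -> forall eta : R, 0 < eta ->
  exists2 M : R, 0 < M & exists N, forall k, (N <= k)%N ->
    expect A 0 k (fun x => (M <= `|x 0 i|)%R%:R) <= eta.
Proof.
move=> A0 /(expect_cvg A0) [nu Anu] eta eta0.
(* A continuous bounded majorant of the indicator of [m.+1 <= |x 0 i|]. Its [nu]-integral tends to 0
   with [m], so one [m] is fixed first and weak convergence is then applied to [g m]. *)
pose g (m : nat) (x : 'rV[R]_d) : R := Num.min 1 (`|x 0 i| / m.+1%:R).
have cg m : continuous (g m).
  apply: (@continuous_comp_coord (fun y => Num.min 1 (`|y| / m.+1%:R))) => y.
  apply: (@continuous_min R _ (cst 1) (fun y => `|y| / m.+1%:R)).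
    exact: cst_continuous.
  by apply: cvgM; [exact: norm_continuous|exact: cvg_cst].
have g0 m x : 0 <= g m x by rewrite le_min ler01/= divr_ge0.
have g1 m x : g m x <= 1 by rewrite ge_min lexx.
have bg m : bounded_fun (g m).
  by apply: (@norm_le_bounded_fun _ _ _ 1) => x; rewrite ger0_norm.
have mg m : measurable_fun setT (g m) by exact: continuous_measurable_mx.
have intg0 : (\int[nu]_x (g m x)%:E @[m --> \oo] --> 0)%E.
  rewrite -(integral0 nu setT).
  have [] // := @dominated_convergence _ _ _ nu setT measurableT
    (fun m x => (g m x)%:E) (cst 0%E) (cst 1%E).
  - by move=> m; exact/measurable_EFinP.
  - apply: aeW => x _; apply/fine_cvgP; split; first exact: nearW.
    apply: (@squeeze_cvgr _ _ _ _ (cst 0) (fun m => `|x 0 i| / m.+1%:R)).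
    + by apply: nearW => m /=; rewrite g0/= ge_min lexx orbT.
    + exact: cvg_cst.
    + rewrite -[X in _ --> X](mulr0 `|x 0 i|); apply: cvgM; first exact: cvg_cst.
      exact: cvg_harmonic.
  - by apply: finite_measure_integrable_cst.
  - by apply: aeW => x m _ /=; rewrite ger0_norm// lee_fin.
move/fine_cvgP : intg0 => [_ /cvgr_lt /(_ eta eta0)] [m _ /(_ m (leqnn _)) mP].
have /cvgr_lt/(_ eta mP) [N _ NP] :
    expect A 0 k (g m) @[k --> \oo] --> fine (\int[nu]_x (g m x)%:E).
  exact: Anu.
exists m.+1%:R => //; exists N => k Nk.
rewrite (le_trans _ (ltW (NP k Nk)))//.
apply: le_expect => x; case: (leP m.+1%:R) => //= mx.
by rewrite /g le_min lexx ler_pdivlMr// mul1r.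
Qed.

(** With mass at most 1/4 outside the region where [cos >= 3/4], the mean cosine is at least
    [3/4 - 2/4 = 1/4]. The bound [delta <= 1] later keeps the angles below [2 <= pi]. *)
Lemma cos_ge_near0 :
  exists2 delta : R, 0 < delta <= 1 & forall y, `|y| <= delta -> 3 / 4 <= cos y.
Proof.
have /cvgrPdist_lt/(_ (4^-1)) : cos y @[y --> (0 : R)] --> cos (0 : R).
  exact: continuous_cos.
rewrite cos0 invr_gt0 ltr0n => /(_ isT)/nbhs_ballP[e /= e0 eP].
exists (Num.min 1 (e / 2)); first by rewrite lt_min ltr01 divr_gt0//= ge_min lexx.
move=> y; rewrite le_min => /andP[_ ye].
have : ball (0 : R) e y by rewrite /ball /= sub0r normrN; lra.
move=> /eP /=; rewrite ltr_norml; lra.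
Qed.

(* In complex notation, [E e^(it(x+y)) = E e^(itx) E e^(ity)] by independence;
   hence a near-constant characteristic function of the partial sums, bounded
   away from 0 at [t], forces that of the increments to be close to 1 at [t]. *)
Lemma expect_trig_split A n k t i :
    let C n k := expect A n k (fun x => cos (t * x 0 i)) in
    let S n k := expect A n k (fun x => sin (t * x 0 i)) in
  C 0%N (n + k)%N = C 0%N n * C n k - S 0%N n * S n k /\
  S 0%N (n + k)%N = S 0%N n * C n k + C 0%N n * S n k.
Proof.
move=> C S; rewrite /C /S; split.
  rewrite expect_split add0n.
  rewrite [C in expect _ _ _ C](_ : _ =
    fun x : 'rV[R]_d => C n k * cos (t * x 0 i) - S n k * sin (t * x 0 i)).
    by rewrite expectB !expectZ !(mulrC (expect A n k _)).
  apply/funext => x; rewrite /C /S !(mulrC (expect A n k _)) -!expectZ -expectB.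
  by congr expect; apply/funext => y; rewrite mxE mulrDr cosD.
rewrite expect_split add0n.
rewrite [C in expect _ _ _ C](_ : _ =
  fun x : 'rV[R]_d => C n k * sin (t * x 0 i) + S n k * cos (t * x 0 i)).
  by rewrite expectD !expectZ !(mulrC (expect A n k _)).
apply/funext => x; rewrite /C /S !(mulrC (expect A n k _)) -!expectZ -expectD.
by congr expect; apply/funext => y; rewrite mxE mulrDr sinD.
Qed.

(** Put [z = c + is] for the first [n] terms and [w = u + iv] for the block. Then
    [|z|^2 |w - 1|^2 = |zw - z|^2 <= 2 rho^2], and [|z| >= 1/4] gives [1 - u <= 4 sqrt(2) rho]. *)
Lemma expect_cos_close A (t rho : R) i n k :
    let C n k := expect A n k (fun x => cos (t * x 0 i)) in
    let S n k := expect A n k (fun x => sin (t * x 0 i)) in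
    4^-1 <= C 0%N n -> 0 <= rho ->
    `|C 0%N (n + k)%N - C 0%N n| <= rho -> `|S 0%N (n + k)%N - S 0%N n| <= rho ->
  1 - C n k <= 8 * rho.
Proof.
move=> C S C4 rho0; have [CE SE] := expect_trig_split A n k t i.
rewrite [C _ (n + k)%N]CE [S _ (n + k)%N]SE -!/(C _ _) -!/(S _ _).
move: (C 0%N n) (S 0%N n) (C n k) (S n k) C4 => c s u v c4.
rewrite !ler_norml => /andP[h1 h2] /andP[h3 h4].
have sq1 : (c * u - s * v - c) ^+ 2 <= rho ^+ 2 by nra.
have sq2 : (s * u + c * v - s) ^+ 2 <= rho ^+ 2 by nra.
have : c ^+ 2 * (1 - u) ^+ 2 <= 2 * rho ^+ 2.
  have : (c ^+ 2 + s ^+ 2) * ((1 - u) ^+ 2 + v ^+ 2) <= 2 * rho ^+ 2.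
    apply: le_trans (_ : (c * u - s * v - c) ^+ 2 + (s * u + c * v - s) ^+ 2 <= _).
      by rewrite le_eqVlt; apply/orP; left; apply/eqP; ring.
    lra.
  by have := sqr_ge0 s; have := sqr_ge0 v; have := sqr_ge0 (1 - u); have := sqr_ge0 c; nra.
have [u1|u1] := leP (1 - u) 0; first by nra.
move=> H; rewrite leNgt; apply/negP => uB.
have : (4^-1 * (8 * rho)) ^+ 2 < (c * (1 - u)) ^+ 2.
  rewrite ltr_pXn2r ?nnegrE//; [nra|nra|nra].
nra.
Qed.

(** If the block sum [y] has [|y| >= 2M], then [|x| >= M] or [|x + y| >= M], where [x] is the sum of
    the first [n] terms. *)
Lemma expect_increment_tail A (M : R) i n k : (forall j, (0 < #|` A j|)%N) ->
  expect A n k (fun x => (M *+ 2 <= `|x 0 i|)%R%:R) <=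
  expect A 0 (n + k) (fun x => (M <= `|x 0 i|)%R%:R) +
  expect A 0 n (fun x => (M <= `|x 0 i|)%R%:R) :> R.
Proof.
move=> A0; rewrite expect_split add0n -expectD.
rewrite -[leLHS](expect_cst 0 n _ A0); apply: le_expect => x.
rewrite -[X in _ + X](expect_cst n k _ A0) -expectD; apply: le_expect => y.
rewrite mxE; case: (leP (M *+ 2)) => /= My; last by rewrite addr_ge0.
have [_|xM] := leP M `|x 0 i|; first by rewrite lerDr.
have [//|xyM] := leP M `|x 0 i + y 0 i|; first by rewrite addr0.
have := ler_normB (x 0 i + y 0 i) (x 0 i); rewrite addrAC subrr add0r.
by rewrite leNgt => /negP[]; rewrite (lt_le_trans _ My)// mulr2n ltrD.
Qed.

Lemma expect_coord_increment A i : (forall j, (0 < #|` A j|)%N) ->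
    infinite_convolution_exists A -> forall e eta : R, 0 < e -> 0 < eta ->
  exists N, forall n k, (N <= n)%N ->
    expect A n k (fun x => (e <= `|x 0 i|)%R%:R) <= eta.
Proof.
move=> A0 Aex e eta e0 eta0.
(* The bound 1/4 keeps the mean cosine at least 1/4; the bound [eta / 4] makes the two tails in
   [expect_increment_tail] add up to at most [eta / 2]. *)
pose eta' : R := Num.min (4^-1) (eta / 4).
have eta'0 : 0 < eta' by rewrite lt_min invr_gt0 ltr0n divr_gt0.
have [M0 M00 [N1 N1P]] := expect_tight i A0 Aex eta'0.
(* Taking [M >= e] ensures [t * e <= delta <= 1] below. *)
pose M := Num.max M0 e.
have M_gt0 : 0 < M by rewrite lt_max M00.
have MP k : (N1 <= k)%N -> expect A 0 k (fun x => (M <= `|x 0 i|)%R%:R) <= eta'.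
  move=> /N1P; apply: le_trans; apply: le_expect => x.
  case: (leP M) => //=; rewrite ge_max => /andP[-> _]//.
have [delta /andP[d0 d1] dP] := cos_ge_near0.
(* At this frequency [|t x| <= delta] whenever [|x| <= M]. *)
pose t := delta / M.
have t0 : 0 < t by rewrite divr_gt0.
pose kappa := 1 - cos (t * e).
have te0 : 0 < t * e by rewrite mulr_gt0.
have te1 : t * e <= 1.
  have eM : e <= M by rewrite le_max lexx orbT.
  by rewrite /t mulrAC ler_pdivrMr//; nra.
have pi2 := @pi_ge2 R.
have kappa0 : 0 < kappa.
  by rewrite subr_gt0 -cos0 ltr_cos// in_itv /=; lra.
have [nu nuP] := expect_cvg A0 Aex.
(* Chosen so that [8 * rho / kappa = eta / 2]. *)
pose rho := kappa * eta / 16.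
have rho0 : 0 < rho by rewrite divr_gt0// mulr_gt0.
have cauchy (phi : R -> R) : continuous phi -> (forall y, `|phi y| <= 1) ->
    exists N, forall n k, (N <= n)%N ->
    `|expect A 0 (n + k) (fun x => phi (x 0 i)) - expect A 0 n (fun x => phi (x 0 i))| <= rho.
  move=> cphi phi1; have /cvgrPdist_lt/(_ (rho / 2)) := nuP (fun x => phi (x 0 i))
    (continuous_comp_coord (i := i) cphi) (norm_le_bounded_fun (fun x => phi1 _)).
  rewrite divr_gt0// => /(_ isT)[N _ NP]; exists N => n k Nn.
  have := NP _ Nn; have /= := NP (n + k)%N (leq_trans Nn (leq_addr _ _)).
  by rewrite !ltr_norml ler_norml => /andP[? ?] /andP[? ?]; apply/andP; split; lra.
have ct (f : R -> R) : continuous f -> continuous (fun y => f (t * y)).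
  move=> cf y; apply: (@continuous_comp _ _ _ (fun y => t * y)); last exact: cf.
  by apply: cvgM; [exact: cvg_cst|exact: cvg_id].
have [N2 N2P] := cauchy (fun y => cos (t * y)) (ct _ (@continuous_cos R))
  (fun y => cos_max _).
have [N3 N3P] := cauchy (fun y => sin (t * y)) (ct _ (@continuous_sin R))
  (fun y => sin_max _).
exists (maxn N1 (maxn N2 N3)) => n k; rewrite !geq_max => /and3P[n1 n2 n3].
have C4 : 4^-1 <= expect A 0 n (fun x => cos (t * x 0 i)).
  apply: le_trans (_ : expect A 0 n (fun x => 3 / 4 - 2 * (M <= `|x 0 i|)%R%:R) <= _).
    rewrite expectB expect_cst// expectZ; have := MP _ n1.
    have : eta' <= 4^-1 by rewrite ge_min lexx.
    lra.
  apply: le_expect => x; case: (leP M) => /= Mx.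
    by have := @cos_geN1 R (t * x 0 i); lra.
  rewrite mulr0 subr0; apply: dP.
  by rewrite normrM gtr0_norm// mulrAC ler_pdivrMr// ler_pM2l// ltW.
have := expect_cos_close C4 (ltW rho0) (N2P n k n2) (N3P n k n3).
have := expect_increment_tail M i n k A0.
have := MP _ n1; have := MP _ (leq_trans n1 (leq_addr k n)).
have : eta' <= eta / 4 by rewrite ge_min lexx orbT.
move=> etaE a1 a2 a3 a4.
(* [1_(e <= |x|) <= 1_(2M <= |x|) + (1 - cos (t x)) / kappa], since [t e <= |t x|]
   and [|t x| <= 2 delta <= pi] in the intermediate range. *)
apply: le_trans (_ : expect A n k (fun x => (M *+ 2 <= `|x 0 i|)%R%:R +
  kappa^-1 * (1 - cos (t * x 0 i))) <= _).
  apply: le_expect => x; have kcos : 0 <= kappa^-1 * (1 - cos (t * x 0 i)).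
    by apply: mulr_ge0; rewrite ?subr_ge0 ?cos_le1// invr_ge0 ltW.
  case: (leP e) => /= ex; last by rewrite addr_ge0.
  case: (leP (M *+ 2)) => /= Mx; first by rewrite lerDl.
  rewrite add0r mulrC ler_pdivlMr// mul1r lerB//.
  have -> : cos (t * x 0 i) = cos (t * `|x 0 i|).
    by case: (ger0P (x 0 i)) => // _; rewrite mulrN cosN.
  have tex : t * e <= t * `|x 0 i| by rewrite ler_pM2l.
  have tMx : t * `|x 0 i| <= 2.
    rewrite /t mulrAC ler_pdivrMr//; rewrite mulr2n in Mx; nra.
  move: tex; rewrite le_eqVlt => /predU1P[->//|tex].
  by rewrite ltW// ltr_cos// in_itv /=; lra.
rewrite expectD expectZ expectB expect_cst//.
have : kappa^-1 * (1 - expect A n k (fun x => cos (t * x 0 i))) <= eta / 2.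
  rewrite mulrC ler_pdivrMr// (le_trans a4)// /rho; lra.
lra.
Qed.

End necessity.

(** * The Cauchy condition in probability and its invariance under equivalence *)

Section cauchy_in_probability.
Context {R : realType} {d : nat}.
Implicit Types (A B : nat -> {fset 'rV[R]_d}).

(** For [e > 0] this says that the sup norm is at least [e]; being boolean, it coerces to an
    indicator function. *)
Definition far (e : R) (x : 'rV[R]_d) : bool := [exists i, e <= `|x 0 i|].

(** The increments of the partial sums enter only through their laws, so no common probability space
    has to be chosen here. *)
Definition expect_cauchy A : Prop := forall e eta : R, 0 < e -> 0 < eta ->
  exists N, forall n k, (N <= n)%N -> expect A n k (fun x => (far e x)%:R) <= eta.

Lemma expect_sum A n k (I : Type) (s : seq I) (F : I -> 'rV[R]_d -> R) :
    (forall j, (0 < #|` A j|)%N) ->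
  expect A n k (fun x => \sum_(i <- s) F i x) = \sum_(i <- s) expect A n k (F i).
Proof.
move=> A0; elim: s => [|i s IH].
  by rewrite big_nil -[RHS](expect_cst n k _ A0); congr expect; apply/funext => x;
    rewrite big_nil.
rewrite big_cons -IH -expectD; congr expect; apply/funext => x.
by rewrite big_cons.
Qed.

Lemma expect_cauchy_of_exists A : (forall j, (0 < #|` A j|)%N) ->
  infinite_convolution_exists A -> expect_cauchy A.
Proof.
move=> A0 Aex e eta e0 eta0.
(* A union bound over the [d] coordinates; dividing by [d.+1] keeps the share positive also for
   [d = 0]. *)
have eta'0 : 0 < eta / d.+1%:R by rewrite divr_gt0.
have [N NP] := choice (fun i => expect_coord_increment i A0 Aex e0 eta'0).
exists (\max_i N i) => n k Nn.
apply: le_trans (_ : expect A n k (fun x => \sum_i (e <= `|x 0 i|)%R%:R) <= _).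
  apply: le_expect => x; have [/existsP[i ei]|_] := boolP (far e x).
    by rewrite (bigD1 i)//= ei lerDl sumr_ge0.
  by rewrite sumr_ge0.
rewrite expect_sum//.
apply: le_trans (_ : \sum_(i < d) eta / d.+1%:R <= _).
  by apply: ler_sum => i _; apply: NP; rewrite (leq_trans _ Nn)// leq_bigmax.
rewrite sumr_const card_ord -[_ *+ d]mulr_natr mulrAC ler_pdivrMr// ler_pM2l//.
by rewrite ler_nat.
Qed.

Lemma equivalent_seqC A B : equivalent_seq A B -> equivalent_seq B A.
Proof.
rewrite /equivalent_seq => AB.
by under eq_eseriesr do rewrite addrC.
Qed.

Lemma nneseries_tail_small (u : nat -> R) : (forall n, 0 <= u n) ->
    (\sum_(0 <= k <oo) (u k)%:E < +oo)%E -> forall eta : R, 0 < eta ->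
  exists N, forall n k, (N <= n)%N -> \sum_(n <= j < n + k) u j <= eta.
Proof.
move=> u0 usum eta eta0.
have := nneseries_tail_cvg usum (fun k _ => u0 k).
move=> /fine_cvgP[[N1 _ N1P] /cvgr_lt/(_ _ eta0)[N2 _ N2P]].
exists (maxn N1 N2) => n k; rewrite geq_max => /andP[n1 n2].
have := N1P _ n1; have /= := N2P _ n2 => h1 h2.
rewrite -lee_fin -sumEFin.
apply: le_trans (_ : (\sum_(n <= i <oo) (u i)%:E <= _)%E); last first.
  by rewrite -(fineK h2) lee_fin ltW.
rewrite (nneseries_split n k)//; last by move=> j _; rewrite lee_fin.
by rewrite leeDl// nneseries_ge0// => j _ _; rewrite lee_fin.
Qed.

Lemma equivalent_expect_cauchy A B : (forall j, (0 < #|` A j|)%N) ->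
    (forall j, (0 < #|` B j|)%N) -> equivalent_seq A B ->
  expect_cauchy A -> expect_cauchy B.
Proof.
move=> A0 B0 AB Ac e eta e0 eta0.
have [N1 N1P] := Ac e (eta / 2) e0 (divr_gt0 eta0 (ltr0Sn _ 1)).
(* A tail of [eta / 4] becomes [eta / 2] through the factor 2 in [expect_dist_le]. *)
have [||N2 N2P] := @nneseries_tail_small (fun k =>
    #|` (B k `\` A k)%fset|%:R / #|` B k|%:R +
    #|` (A k `\` B k)%fset|%:R / #|` A k|%:R) _ AB (eta / 4).
- by move=> k; rewrite addr_ge0// divr_ge0.
- by rewrite divr_gt0.
exists (maxn N1 N2) => n k; rewrite geq_max => /andP[n1 n2].
have fle1 x : `|(far e x)%:R| <= 1 :> R by case: far; rewrite ?normr1 ?normr0.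
have := expect_dist_le n k A0 B0 fle1.
rewrite ler_norml => /andP[]; have := N1P n k n1; have := N2P n k n2; lra.
Qed.

End cauchy_in_probability.

(** * Mixed radix digits of a uniform variable *)

Section unit_interval.
Context {R : realType}.
Local Open Scope ereal_scope.

Notation lambda := (@lebesgue_measure R).

Definition unit_prob : set (measurableTypeR R) -> \bar R :=
  mrestr lambda (measurable_itv `[0%R, 1%R[).

HB.instance Definition _ := Measure.on unit_prob.

Let unit_prob_setT : unit_prob setT = 1.
Proof.
by rewrite /unit_prob /mrestr setTI lebesgue_measure_itv /= lte_fin ltr01 oppr0 adde0.
Qed.

HB.instance Definition _ :=
  Measure_isProbability.Build _ _ _ unit_prob unit_prob_setT.

Variables (q : nat) (q0 : (0 < q)%N).

(** The inverse branches of [u |-> q u mod 1]: for [i < q], [branch i] maps [0, 1) onto the numbers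
    whose first base-[q] digit is [i]. *)
Definition branch (i : nat) (v : measurableTypeR R) : measurableTypeR R :=
  ((i%:R + v) / q%:R)%R.

Lemma measurable_branch i : measurable_fun setT (branch i).
Proof.
by apply: measurable_funM => //; apply: measurable_funD.
Qed.

(** The image measure under [branch i], divided by [q], gives half-open intervals their length, and
    this characterizes Lebesgue measure. *)
Lemma lebesgue_measure_branch i B : measurable B ->
  lambda (branch i @^-1` B) = q%:R%:E * lambda B.
Proof.
move=> mB; have qR : (0 < q%:R :> R)%R by rewrite ltr0n.
have qV0 : (0 <= q%:R^-1 :> R)%R by rewrite invr_ge0.
pose m : {measure set (measurableTypeR R) -> \bar R} :=
  mscale (NngNum qV0)
    (measure_function_pushforward__canonical__measure_function_Measure
       lambda (measurable_branch i)).
have -> : lambda B = m B.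
  apply: lebesgue_measure_unique => // _ [[a b] _ <-].
  rewrite /m /= /mscale /= /pushforward.
  rewrite (_ : _ @^-1` _ = `](q%:R * a - i%:R)%R, (q%:R * b - i%:R)%R]%classic); last first.
    apply/seteqP; split => v /=; rewrite !in_itv /= /branch ltr_pdivlMr// ler_pdivrMr//;
      by rewrite ltrBlDl lerBrDl ![(_ * q%:R)%R]mulrC.
  rewrite !lebesgue_measure_itv /= !lte_fin ltrD2r ltr_pM2l//.
  case: ifPn => ab; last by rewrite mule0.
  by rewrite -!EFinD -EFinM; congr (_%:E); field; rewrite gt_eqF.
by rewrite /m /= /mscale /= muleA -EFinM mulfV ?gt_eqF// mul1e.
Qed.

(** Self-similarity of the uniform law: the first digit is uniform and, given it, the remainder is
    again uniform on [0, 1). *)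
Lemma unit_prob_branch B : measurable B ->
  unit_prob B = (q%:R^-1)%:E * \sum_(i < q) unit_prob (branch i @^-1` B).
Proof.
move=> mB; have qR : (0 < q%:R :> R)%R by rewrite ltr0n.
pose J i : set R := `[(i%:R / q%:R)%R, (i.+1%:R / q%:R)%R[%classic.
have mJ i : measurable (B `&` J i) by apply: measurableI => //; exact: measurable_itv.
have branchE i : unit_prob (branch i @^-1` B) = q%:R%:E * lambda (B `&` J i).
  rewrite -(lebesgue_measure_branch i)// /unit_prob /mrestr; congr (lambda _).
  rewrite preimage_setI /J; congr (_ `&` _); apply/seteqP; split => v /=;
    rewrite !in_itv /= /branch ler_pM2r ?invr_gt0// ltr_pM2r ?invr_gt0//;
    by rewrite lerDl -natr1 ltrD2l.
under eq_bigr do rewrite branchE.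
rewrite -ge0_sume_distrr//.
rewrite muleA -EFinM mulVf ?gt_eqF// mul1e.
have -> : unit_prob B = lambda (B `&` `[0%R, (q%:R / q%:R)%R[%classic).
  by rewrite mulfV ?gt_eqF.
(* The right endpoint is freed from [q] so that the cells [J i] can be added one by one. *)
suff H m : lambda (B `&` `[0%R, (m%:R / q%:R)%R[%classic) =
    \sum_(i < m) lambda (B `&` J i) by rewrite H.
elim: m => [|m IH].
  rewrite big_ord0 mul0r (_ : _ `&` _ = set0) ?measure0// -subset0 => x [_ /=].
  by rewrite in_itv /= => /andP[]; case: leP.
rewrite big_ord_recr /= -IH -measureU//.
- rewrite -setIUr /J; congr (lambda (_ `&` _)).
  have m0 : (0 <= m%:R / q%:R :> R)%R by rewrite divr_ge0.
  have m1 : (m%:R / q%:R <= m.+1%:R / q%:R :> R)%R by rewrite ler_pM2r ?invr_gt0// ler_nat.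
  apply/seteqP; split => x /=; rewrite !in_itv /=.
    move=> /andP[x0 xm]; case: (ltP x (m%:R / q%:R)%R) => h; [left|right].
      by rewrite x0.
    by rewrite xm.
  by case=> /andP[a b]; apply/andP; split; lra.
- by apply: measurableI => //; exact: measurable_itv.
- rewrite /J -subset0 => x [[_ /=] + [_ /=]]; rewrite !in_itv /= => /andP[_ a] /andP[b _].
  by move: a; rewrite ltNge b.
Qed.

Lemma ge0_integral_unit_prob_branch (h : measurableTypeR R -> \bar R) :
    measurable_fun setT h -> (forall x, 0 <= h x) ->
  \int[unit_prob]_x h x =
  (q%:R^-1)%:E * \sum_(i < q) \int[unit_prob]_x h (branch i x).
Proof.
move=> mh h0.
pose m i := measure_function_pushforward__canonical__measure_function_Measure
       unit_prob (measurable_branch i).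
have qV0 : (0 <= q%:R^-1 :> R)%R by rewrite invr_ge0.
rewrite (eq_measure_integral (mscale (NngNum qV0) (msum m q))); last first.
  by move=> B mB _; exact: unit_prob_branch.
rewrite ge0_integral_mscale// ge0_integral_measure_sum//.
congr (_ * _); apply: eq_bigr => i _.
by rewrite ge0_integral_pushforward//; exact: measurable_branch.
Qed.

End unit_interval.

Section digits.
Context {R : realType} {d : nat}.
Variable A : nat -> {fset 'rV[R]_d}.
Hypothesis A0 : forall j, (0 < #|` A j|)%N.
Local Notation U := (measurableTypeR R).

(* Reading [u] in mixed radix [#|` A n|, #|` A n.+1|, ...], its digits select
   one point of each [A j], and [digit_sum n k u] adds up the first [k] of them. *)
Fixpoint digit_sum (n k : nat) (u : R) : 'rV[R]_d :=
  if k is k'.+1 then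
    let q := #|` A n| in
    \sum_(i < q) \1_`[(i%:R : R), i.+1%:R[%classic (q%:R * u) *:
      ((A n)`_i + digit_sum n.+1 k' (q%:R * u - i%:R))
  else 0.

Lemma digit_sum_branch n k (i : 'I_#|` A n|) (v : R) : 0 <= v < 1 ->
  digit_sum n k.+1 (branch #|` A n| i v) = (A n)`_i + digit_sum n.+1 k v.
Proof.
move=> /andP[v0 v1]; have qR : 0 < #|` A n|%:R :> R by rewrite ltr0n.
rewrite /= /branch (_ : #|` A n|%:R * _ = i%:R + v); last first.
  by rewrite mulrC divfK ?gt_eqF.
rewrite (bigD1 i)//= big1 ?addr0.
  rewrite indicE mem_set ?scale1r; last by rewrite /= in_itv /= -natr1; lra.
  by rewrite addrAC subrr add0r.
move=> j ji; rewrite indicE memNset ?scale0r//= in_itv /= => /andP[h1 h2].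
have : (i < j.+1)%N by rewrite -(ltr_nat R); lra.
have : (j < i.+1)%N by rewrite -(ltr_nat R) -natr1; lra.
rewrite !ltnS => ji' ij; move/negP: ji; apply; apply/eqP/val_inj/eqP => /=.
by rewrite eqn_leq ji' ij.
Qed.

Lemma measurable_digit_sum n k : measurable_fun [set: U] (digit_sum n k).
Proof.
elim: k n => [|k IH] n /=; first exact: measurable_cst.
apply: measurable_fun_mx => i j.
under eq_fun do rewrite summxE.
apply: measurable_sum => l; under eq_fun do rewrite !mxE.
have mq : measurable_fun [set: U] (fun u : U => #|` A n|%:R * u : U).
  exact: measurable_funM.
have mqB : measurable_fun [set: U] (fun u : U => #|` A n|%:R * u - l%:R : U).
  exact: measurable_funB.
apply: measurable_funM.
  have m1 : measurable_fun [set: U] (\1_`[(l%:R : R), l.+1%:R[%classic : U -> R).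
    by apply: measurable_indic; exact: measurable_itv.
  exact: (measurableT_comp m1 mq).
apply: measurable_funD; first exact: measurable_cst.
apply: (measurableT_comp (measurable_coord_mx i j)).
exact: (measurableT_comp (IH n.+1) mqB).
Qed.

(** Integrals against [unit_prob] range over the whole line, whereas [digit_sum_branch] needs [v] in
    [0, 1). *)
Lemma unit_prob_ae : {ae (@unit_prob R), forall v, 0 <= v < 1}.
Proof.
exists (~` `[0, 1[%classic); split; first by apply: measurableC; exact: measurable_itv.
  by rewrite /= /unit_prob /mrestr setICl measure0.
by move=> v /= h; contradict h; move: h; rewrite /= in_itv.
Qed.

(** Averaging over the branches draws the first point uniformly from [A n] and leaves a uniform
    variable for the later digits, which is the recursion of [expect]. *)
Lemma integral_digit_sum n k (f : 'rV[R]_d -> R) :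
    measurable_fun setT f -> (forall x, 0 <= f x) ->
  (\int[@unit_prob R]_u (f (digit_sum n k u))%:E = (expect A n k f)%:E)%E.
Proof.
move=> mf f0; elim: k n f mf f0 => [|k IH] n f mf f0.
  rewrite [digit_sum _ _]/= integral_cst// -[RHS]mule1; congr (_ * _)%E.
  exact: probability_setT.
have mfS : measurable_fun [set: U] (fun u => (f (digit_sum n k.+1 u))%:E).
  apply/measurable_EFinP; exact: (measurableT_comp mf (measurable_digit_sum _ _)).
rewrite (ge0_integral_unit_prob_branch (A0 n) mfS); last by move=> x; rewrite lee_fin.
rewrite [expect _ _ _ _]/= /avg EFinM; congr (_ * _)%E.
rewrite (big_nth 0) big_mkord -sumEFin; apply: eq_bigr => i _.
have mfa : measurable_fun setT (fun x => f ((A n)`_i + x)).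
  exact: (measurableT_comp mf (measurable_addl_mx _)).
rewrite -IH//.
apply: ae_eq_integral => //.
- by apply: (measurableT_comp mfS); exact: measurable_branch.
- by apply/measurable_EFinP; exact: (measurableT_comp mfa (measurable_digit_sum _ _)).
- have [N [mN N0 NP]] := unit_prob_ae; exists N; split => // v /= nv; apply: NP => v01.
  by apply: nv => _; congr (f _)%:E; exact: digit_sum_branch.
Qed.

(** On each branch the first point cancels in the difference, so all branches contribute the same
    value. *)
Lemma integral_digit_sum_increment n j k (f : 'rV[R]_d -> R) :
    measurable_fun setT f -> (forall x, 0 <= f x) ->
  (\int[@unit_prob R]_u (f (digit_sum n (j + k) u - digit_sum n j u)%R)%:E =
   (expect A (n + j) k f)%:E)%E.
Proof.
move=> mf f0; elim: j n => [|j IH] n.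
  rewrite addn0 -integral_digit_sum//.
  by apply: eq_integral => u _; rewrite add0n subr0.
have mfS m l l' : measurable_fun [set: U]
    (fun u => (f (digit_sum m l u - digit_sum m l' u))%:E).
  apply/measurable_EFinP; apply: (measurableT_comp mf).
  apply: measurable_fun_mx => a b; under eq_fun do rewrite !mxE.
  by apply: measurable_funB; apply: (measurableT_comp (measurable_coord_mx a b));
    exact: measurable_digit_sum.
rewrite (ge0_integral_unit_prob_branch (A0 n) (mfS _ _ _)); last first.
  by move=> x; rewrite lee_fin.
transitivity ((#|` A n|%:R^-1)%:E *
    \sum_(i < #|` A n|) (expect A (n.+1 + j)%N k f)%:E)%E.
  congr (_ * _)%E; apply: eq_bigr => i _; rewrite -IH.
  apply: ae_eq_integral => //.
  - by apply: (measurableT_comp (mfS _ _ _)); exact: measurable_branch.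
  - have [N [mN N0 NP]] := unit_prob_ae; exists N; split => // v /= nv; apply: NP => v01.
    apply: nv => _; congr (f _)%:E.
    transitivity ((A n)`_i + digit_sum n.+1 (j + k) v - ((A n)`_i + digit_sum n.+1 j v)).
      by congr (_ - _); exact: digit_sum_branch.
    by rewrite opprD addrACA subrr add0r.
rewrite sumEFin -EFinM addSnnS; congr _%:E.
by rewrite sumr_const card_ord -(mulr_natl (expect _ _ _ _)) mulKf// pnatr_eq0 -lt0n.
Qed.

End digits.

(** * Limits of sequences that are Cauchy in probability *)

Section limit_in_probability.
Context {R : realType} {d : nat}.

Lemma measurable_far (e : R) : measurable [set x : 'rV[R]_d | far e x].
Proof.
rewrite (_ : [set _ | _] = \bigcup_(i in [set: 'I_d])
    ((fun x : 'rV[R]_d => x 0 i) @^-1` (Num.Def.normr @^-1` `[e, +oo[%classic))).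
  apply: fin_bigcup_measurable => [|i _]; first exact: finite_finset.
  rewrite -[X in measurable X]setTI.
  apply: measurable_coord_mx => //; rewrite -[X in measurable X]setTI.
  by apply: normr_measurable => //; exact: measurable_itv.
apply/seteqP; split => x /=.
  by move=> /existsP[i ei]; exists i => //=; rewrite in_itv /= andbT.
by move=> [i _ /=]; rewrite in_itv /= andbT => ei; apply/existsP; exists i.
Qed.

Lemma cvg_mx_coord (I : nat -> 'rV[R]_d) (x : 'rV[R]_d) :
  (forall i, I k 0 i @[k --> \oo] --> x 0 i) -> I k @[k --> \oo] --> x.
Proof.
move=> Ix U [P Px PU].
have : \forall k \near \oo, forall i, P 0 i (I k 0 i).
  by apply: filter_forall => i; exact: Ix (Px 0 i).
by apply: filterS => k Pk; apply: PU => a i; rewrite (ord1 a).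
Qed.

Lemma geometric_steps_cvg (x : nat -> R) :
    (\forall j \near \oo, `|x j.+1 - x j| <= ((2 ^ j.+1)%:R)^-1) ->
  cvgn x.
Proof.
move=> [J _ JP].
(* Keeping the subtracted term lets the induction close: each new step is at most the difference of
   two consecutive powers. *)
have step m k : (J <= m)%N ->
    `|x (m + k)%N - x m| <= ((2 ^ m)%:R)^-1 - ((2 ^ (m + k))%:R)^-1.
  move=> Jm; elim: k => [|k IH]; first by rewrite addn0 !subrr normr0.
  have -> : x (m + k.+1)%N - x m = (x (m + k).+1 - x (m + k)%N) + (x (m + k)%N - x m).
    by rewrite addnS addrA subrK.
  rewrite (le_trans (ler_normD _ _))//.
  have /= h := JP (m + k)%N (leq_trans Jm (leq_addr _ _)).
  have E : ((2 ^ (m + k))%:R)^-1 = 2 * ((2 ^ (m + k).+1)%:R)^-1 :> R.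
    by rewrite expnS natrM invfM mulVKf.
  by rewrite addnS; move: h IH; rewrite E; lra.
apply: cauchy_cvg; apply: cauchy_exP => e /= e0.
have /cvgrPdist_lt/(_ e e0)[K _ KP] : geometric 1 (2^-1 : R) @ \oo --> (0 : R).
  by apply: cvg_geometric; rewrite ger0_norm ?invr_ge0// invf_lt1 ?ltr1n.
pose m := maxn J K.
exists (x m), m => // k /= mk.
rewrite /ball /= distrC -(subnKC mk).
apply: le_lt_trans (step _ _ (leq_maxl _ _)) _.
have := KP m (leq_maxr _ _).
rewrite /geometric /= sub0r normrN mul1r ger0_norm ?exprn_ge0// exprVn -natrX.
by apply: le_lt_trans; rewrite gerBl invr_ge0.
Qed.

Context {disp} {T : measurableType disp} (P : probability T R).
Variable S : nat -> T -> 'rV[R]_d.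
Hypothesis mS : forall k, measurable_fun setT (S k).
Hypothesis S_cauchy : forall e eta : R, 0 < e -> 0 < eta -> exists N, forall n k,
  (N <= n)%N -> (P [set u | far e (S (n + k) u - S n u)] <= eta%:E)%E.

Let eps (j : nat) : R := ((2 ^ j.+1)%:R)^-1.

Let eps_gt0 j : 0 < eps j.
Proof. by rewrite invr_gt0 ltr0n expn_gt0. Qed.

Let eps_cvg : eps j @[j --> \oo] --> 0.
Proof.
rewrite (_ : (fun j => eps j) = geometric 2^-1 2^-1).
  by apply: cvg_geometric; rewrite ger0_norm ?invr_ge0// invf_lt1 ?ltr1n.
by apply/funext => j; rewrite /eps /geometric /= -exprS exprVn natrX.
Qed.

Let fast_subsequence : exists nn : nat -> nat,
  (forall j, (nn j <= nn j.+1)%N) /\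
  forall j k, (nn j <= k)%N -> (P [set u | far (eps j) (S k u - S (nn j) u)] <= (eps j)%:E)%E.
Proof.
have [N NP] := choice (fun j => S_cauchy (eps_gt0 j) (eps_gt0 j)).
(* Partial sums of [N] are nondecreasing and dominate each [N j]. *)
exists (fun j => \sum_(l < j.+1) N l)%N; split => [j|j k nk].
  by rewrite [leqRHS]big_ord_recr leq_addr.
by rewrite -(subnKC nk); apply: NP; rewrite big_ord_recr leq_addl.
Qed.

Let measurable_far_increment e k l : measurable [set u | far e (S k u - S l u)].
Proof.
rewrite -[X in measurable X]setTI.
have mD : measurable_fun setT (fun u => S k u - S l u).
  apply: measurable_fun_mx => i j; under eq_fun do rewrite !mxE.
  by apply: measurable_funB; apply: (measurableT_comp (measurable_coord_mx i j)).
exact: mD (measurable_far e).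
Qed.

(** Borel-Cantelli: the [eps j] have sum 1, so the limsup of the bad events is null. *)
Let ae_close (k l : nat -> nat) :
    (forall j, P [set u | far (eps j) (S (k j) u - S (l j) u)] <= (eps j)%:E)%E ->
  {ae P, forall u, \forall j \near \oo, ~~ far (eps j) (S (k j) u - S (l j) u)}.
Proof.
move=> klP; pose F j := [set u | far (eps j) (S (k j) u - S (l j) u)].
have mF j : measurable (F j) by exact: measurable_far_increment.
exists (lim_sup_set F); split.
- by apply: bigcapT_measurable => n; apply: bigcup_measurable => j _.
- apply: lim_sup_set_cvg0 => //.
  apply: le_lt_trans (ltry 1); apply: le_trans (epsilon_trick0 xpredT ler01).
  by apply: lee_nneseries => // j _; rewrite div1r; exact: klP.
- move=> u /= nu n _; apply: contrapT => h; apply: nu; exists n => // j /= nj.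
  by apply/negP => Fj; apply: h; exists j.
Qed.

(** Along [nn] the sums converge almost surely to [X]; dominated convergence then passes to
    integrals of bounded continuous functions. *)
Lemma cauchy_in_probability_limit : exists2 X : T -> 'rV[R]_d, measurable_fun setT X &
  forall f : 'rV[R]_d -> R, continuous f -> bounded_fun f ->
    (\int[P]_u (f (S k u))%:E @[k --> \oo] --> \int[P]_u (f (X u))%:E)%E.
Proof.
have [nn [nn_le nnP]] := fast_subsequence.
(* [limn_esup] makes the limit total and measurable without restricting to the
   set of convergence. *)
pose X u : 'rV[R]_d := \row_i fine (limn_esup (fun j => (S (nn j) u 0 i)%:E)).
have mX : measurable_fun setT X.
  apply: measurable_fun_mx => a i; under eq_fun do rewrite mxE.
  apply: measurableT_comp; first exact: fine_measurable.
  apply: measurable_fun_limn_esup => j; apply/measurable_EFinP.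
  exact: (measurableT_comp (measurable_coord_mx 0 i)).
have X_lim : {ae P, forall u i, S (nn j) u 0 i @[j --> \oo] --> X u 0 i}.
  have [N [mN N0 NP]] := ae_close (fun j => nnP j _ (nn_le j)).
  exists N; split => // u /= nu; apply: NP => h; apply: nu => i.
  have cv : cvgn (fun j => S (nn j) u 0 i).
    apply: geometric_steps_cvg; apply: filterS h => j /existsPn /(_ i).
    by rewrite !mxE -ltNge => /ltW.
  rewrite /X mxE is_cvg_limn_esupE; last first.
    by apply/cvg_ex; exists (limn (fun j => S (nn j) u 0 i))%:E; apply: cvg_EFin => //;
      exact: nearW.
  by rewrite EFin_lim.
exists X => // f cf bf.
(* For such [k], [S (k j)] is almost surely within [eps j] of [S (nn j)] for large [j], hence has
   the same limit [X]. *)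
have sub_lim (k : nat -> nat) : (forall j, (nn j <= k j)%N) ->
    (\int[P]_u (f (S (k j) u))%:E @[j --> \oo] --> \int[P]_u (f (X u))%:E)%E.
  move=> nk; have mf := continuous_measurable_mx cf.
  have [M M0 fM] := bounded_fun_norm_le bf.
  have [] // := @dominated_convergence _ _ _ P setT measurableT
    (fun j u => (f (S (k j) u))%:E) (fun u => (f (X u))%:E) (cst M%:E).
  - by move=> j; apply/measurable_EFinP; exact: (measurableT_comp mf).
  - by apply/measurable_EFinP; exact: (measurableT_comp mf).
  - have [N [mN N0 NP]] := ae_close (fun j => nnP j _ (nk j)).
    have [N' [mN' N'0 N'P]] := X_lim.
    exists (N `|` N'); split; [exact: measurableU|exact: null_set_setU|].
    move=> u /= nu; apply: contrapT => /not_orP[uN uN'].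
    have close : \forall j \near \oo, ~~ far (eps j) (S (k j) u - S (nn j) u).
      by apply: contrapT => h; apply: uN; exact: NP.
    have lim i : S (nn j) u 0 i @[j --> \oo] --> X u 0 i.
      by move: i; apply: contrapT => h; apply: uN'; exact: N'P.
    have SX : S (k j) u @[j --> \oo] --> X u.
      apply: cvg_mx_coord => i.
      rewrite (_ : (fun j => S (k j) u 0 i) =
        (fun j => (S (k j) u 0 i - S (nn j) u 0 i) + S (nn j) u 0 i)); last first.
        by apply/funext => j; rewrite subrK.
      rewrite -[X in _ --> X]add0r; apply: cvgD => //.
      apply: (@squeeze_cvgr _ _ _ _ (fun j => - eps j) eps).
      + apply: filterS close => j /existsPn /(_ i).
        by rewrite !mxE -ltNge ltr_norml => /andP[/ltW-> /ltW->].
      + by rewrite -oppr0; apply: cvgN; exact: eps_cvg.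
      + exact: eps_cvg.
    apply: nu => _; apply: cvg_EFin; first exact: nearW.
    exact: (cvg_comp (fun j => S (k j) u) f SX (cf _)).
  - by apply: finite_measure_integrable_cst.
  - by apply: aeW => u j _; rewrite /= lee_fin.
(* [sub_lim] holds for all [k] dominating [nn], so a failure of convergence along
   the whole sequence would be seen along one such [k]. *)
move=> U LU; apply: contrapT => nU.
have /choice[k kP] j : exists k, (nn j <= k)%N /\ ~ U (\int[P]_u (f (S k u))%:E)%E.
  apply: contrapT => h; apply: nU; exists (nn j) => // k /= nk.
  by apply: contrapT => nUk; apply: h; exists k.
have [J _ /(_ J (leqnn _)) /=] := sub_lim k (fun j => (kP j).1) _ LU.
exact: (kP J).2.
Qed.

End limit_in_probability.

(** * The infinite convolution as the law of the limit of the digit sums *)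

Section sufficiency.
Context {R : realType} {d : nat}.
Variable A : nat -> {fset 'rV[R]_d}.
Hypothesis A0 : forall j, (0 < #|` A j|)%N.

Lemma unit_prob_far_increment (e : R) n k :
  @unit_prob R [set u | far e (digit_sum A 0 (n + k) u - digit_sum A 0 n u)] =
  (expect A n k (fun x => (far e x)%:R))%:E.
Proof.
have farE (x : 'rV[R]_d) : (far e x)%:R = \1_[set x | far e x] x :> R.
  rewrite indicE; congr (_%:R).
  by have [h|/negP h] := boolP (far e x); [rewrite mem_set|rewrite memNset].
have mfar : measurable_fun [set: 'rV[R]_d] (fun x => (far e x)%:R : R).
  under eq_fun do rewrite farE.
  by apply: measurable_indic; exact: measurable_far.
have := @integral_digit_sum_increment _ _ _ A0 0 n k _ mfar (fun=> ler0n _ _).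
rewrite add0n => <-.
have mD : measurable_fun [set: measurableTypeR R]
    (fun u => digit_sum A 0 (n + k) u - digit_sum A 0 n u).
  apply: measurable_fun_mx => i j; under eq_fun do rewrite !mxE.
  by apply: measurable_funB; apply: (measurableT_comp (measurable_coord_mx i j));
    exact: measurable_digit_sum.
have mB := mD measurableT _ (measurable_far e); rewrite setTI in mB.
transitivity (\int[@unit_prob R]_u (\1_[set u | far e
    (digit_sum A 0 (n + k) u - digit_sum A 0 n u)] u)%:E)%E.
  by rewrite integral_indic// setIT.
by apply: eq_integral => u _; rewrite farE.
Qed.

Lemma exists_of_expect_cauchy : expect_cauchy A -> infinite_convolution_exists A.
Proof.
move=> Ac; have mS k := @measurable_digit_sum R d A 0 k.
have [|X mX Xlim] := cauchy_in_probability_limit (P := @unit_prob R) mS.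
  move=> e eta e0 eta0; have [N NP] := Ac e eta e0 eta0.
  exists N => n k Nn; have := NP n k Nn.
  by rewrite -lee_fin -unit_prob_far_increment.
pose X' : {mfun measurableTypeR R >-> 'rV[R]_d} :=
  HB.pack X (isMeasurableFun.Build _ _ _ _ X mX).
exists (distribution (@unit_prob R) X') => f cf bf.
have mf := continuous_measurable_mx cf.
have [M M0 fM] := bounded_fun_norm_le bf.
rewrite integral_distribution//; last 2 first.
- exact/measurable_EFinP.
- apply: (@measurable_bounded_integrable _ _ _ _ (f \o X)) => //.
  + by rewrite [X in (X < _)%E](probability_setT (@unit_prob R)) ltry.
  + exact: (measurableT_comp mf mX).
  + by apply: (@norm_le_bounded_fun _ _ _ M) => x /=.
have := Xlim f cf bf.
(* The shift pairs [conv_seq A k] with the digit sum of [k.+1] terms. *)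
rewrite -cvg_shiftS.
rewrite (_ : (fun n => _) = (fun k => (\int[conv_seq A k]_x (f x)%:E)%E))//.
apply/funext => k; rewrite integral_conv_seq//.
apply: (@integral_shift_eq _ _ _ (@unit_prob R) (fun u => f (digit_sum A 0 k.+1 u)) _ M).
- exact: probability_setT.
- exact: (measurableT_comp mf (mS _)).
- by apply: (@norm_le_bounded_fun _ _ _ M).
rewrite (integral_digit_sum A0 0 k.+1 (f := fun x => f x + M)).
- by rewrite expectD [X in _ + X](expect_cst 0 k.+1 M A0).
- exact: measurable_funD.
- by move=> x; rewrite -lerBlDr sub0r; have := fM x; rewrite ler_norml => /andP[].
Qed.

End sufficiency.

Theorem theorem2p2 (R : realType) (d : nat) (A A' : nat -> {fset 'rV[R]_d})
  (hA : forall k, (2 <= #|` A k|)%N) (hA' : forall k, (2 <= #|` A' k|)%N)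
  (heq : equivalent_seq A A') :
  infinite_convolution_exists A <-> infinite_convolution_exists A'.
Proof.
have A0 k : (0 < #|` A k|)%N by exact: ltnW.
have A'0 k : (0 < #|` A' k|)%N by exact: ltnW.
have eqA'A := equivalent_seqC heq.
by split => /expect_cauchy_of_exists Ac; apply: exists_of_expect_cauchy => //;
  [apply: (equivalent_expect_cauchy A0 A'0 heq)|
   apply: (equivalent_expect_cauchy A'0 A0 eqA'A)]; exact: Ac.
Qed.
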